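(* Let $k,n\ge 2$, let $B_0,\dots,B_{k-1}$ be $n\times n$ generic commuting matrices over $\mathbb{Q}$, let $K$ be the field generated over $\mathbb{Q}$ by all their entries and $\overline{K}$ its algebraic closure. Consider either one of the two equations $$X^k+X^{k-1}B_{k-1}+\cdots+XB_1+B_0=0_n,\qquad X^k+B_{k-1}X^{k-1}+\cdots+B_1X+B_0=0_n$$ in the unknown $X\in\mathcal{M}_n(\overline{K})$. Then there are $k^n$ solutions, and any solution $X\in\mathcal{M}_n(\overline{K})$ commutes with all the $B_i$, $0\le i\le k-1$.
   Context: Generic commuting matrices: let $B_r=[b_{r;i,j}]\in\mathcal{M}_n(L)$, $0\le r\le k-1$, where $L$ is a transcendental extension of $\mathbb{Q}$. Let $\mathcal{I}$ be the ideal over $\mathbb{Q}$ (in the polynomial ring over $\mathbb{Q}$ in the $kn^2$ entries of $n\times n$ matrices of indeterminates $U_0,\dots,U_{k-1}$) generated by the commutativity relations $U_iU_j=U_jU_i$ for all $0\le i<j\le k-1$. The $B_r$ are said to be generic commuting matrices over $\mathbb{Q}$ if they pairwise commute and, for every polynomial $P\notin\mathcal{I}$ over $\mathbb{Q}$, $P(\{b_{r;i,j}\}_{r,i,j})\neq 0$. *)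

(* Defs.v *)
From HB Require Import structures.
From mathcomp Require Import all_boot all_order all_algebra.
From mathcomp Require Import mpoly.

Set Implicit Arguments.
Unset Strict Implicit.
Unset Printing Implicit Defensive.

Import GRing.Theory.
Local Open Scope ring_scope.

(* The position (r, i, j) of the entry in row i and column j of the r-th of
   k matrices of size n; it indexes the k n^2 variables via enum_rank. *)
Definition entry (k n : nat) : finType := ('I_k * 'I_n * 'I_n)%type.

Definition indet_mx (k n : nat) (r : 'I_k) : 'M[{mpoly rat[#|entry k n|]}]_n :=
  \matrix_(i, j) 'X_(enum_rank ((r, i, j) : entry k n)).

(* The ideal generated by the entries of U_r U_s - U_s U_r for r < s. *)
Definition in_comm_ideal (k n : nat) (P : {mpoly rat[#|entry k n|]}) : Prop :=
  exists c : 'I_k -> 'I_k -> 'I_n -> 'I_n -> {mpoly rat[#|entry k n|]},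
    P = \sum_(r < k) \sum_(s < k | (r < s)%N) \sum_(i < n) \sum_(j < n)
          c r s i j *
          (indet_mx n r *m indet_mx n s - indet_mx n s *m indet_mx n r) i j.

Definition eval_entries (L : fieldType) (iota : {rmorphism rat -> L})
    (k n : nat) (B : 'I_k -> 'M[L]_n) (P : {mpoly rat[#|entry k n|]}) : L :=
  mmap iota
    (fun v : 'I_#|entry k n| =>
       let: (r, i, j) := (enum_val v : entry k n) in B r i j) P.

Definition generic_commuting (L : fieldType) (iota : {rmorphism rat -> L})
    (k n : nat) (B : 'I_k -> 'M[L]_n) : Prop :=
  (forall r s, B r *m B s = B s *m B r) /\
  (forall P : {mpoly rat[#|entry k n|]},
     ~ in_comm_ideal P -> eval_entries iota B P != 0).

Definition transcendental_extension (F L : fieldType)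
    (iota : {rmorphism F -> L}) : Prop :=
  exists x : L, ~ algebraicOver iota x.

Definition subfield_over_Q (L : fieldType) (iota : {rmorphism rat -> L})
    (S : L -> Prop) : Prop :=
  [/\ forall q, S (iota q),
      forall x y, S x -> S y -> S (x - y),
      forall x y, S x -> S y -> S (x * y)
    & forall x, S x -> S x^-1].

Definition in_entry_field (L : fieldType) (iota : {rmorphism rat -> L})
    (k n : nat) (B : 'I_k -> 'M[L]_n) (x : L) : Prop :=
  forall S : L -> Prop, subfield_over_Q iota S ->
    (forall r i j, S (B r i j)) -> S x.

Definition is_algebraic_closure (K : fieldType) (Kbar : closedFieldType)
    (emb : {rmorphism K -> Kbar}) : Prop :=
  forall z : Kbar, algebraicOver emb z.

Definition right_coef_solution (F : fieldType) (k n : nat)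
    (B : 'I_k -> 'M[F]_n) (X : 'M[F]_n) : Prop :=
  X ^+ k + \sum_(r < k) X ^+ r *m B r = 0.

Definition left_coef_solution (F : fieldType) (k n : nat)
    (B : 'I_k -> 'M[F]_n) (X : 'M[F]_n) : Prop :=
  X ^+ k + \sum_(r < k) B r *m X ^+ r = 0.

Definition has_exactly (T : eqType) (m : nat) (S : T -> Prop) : Prop :=
  exists s : seq T, [/\ uniq s, size s = m & forall x, x \in s <-> S x].

(* Main.v *)
(* A resultant in the entries of the indeterminate matrices that does not vanish
   at one commuting tuple of rational matrices is outside the ideal I, hence does
   not vanish at the generic tuple. Testing on diagonal tuples, the characteristic
   polynomials of the B_r and det (t^k + sum_r t^r B_r) are all separable. The B_r
   are therefore simultaneously diagonalizable over the algebraic closure, with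
   diagonals d_r, and f_j(t) = t^k + sum_r d_{r,j} t^r are pairwise coprime and
   separable of degree k, since their product is the above determinant. The j-th
   column of the first equation reads f_j(X) e_j = 0; by Bezout, the projection
   onto the j-th coordinate is then a polynomial in X, so X is diagonal, and its
   j-th entry is any of the k roots of f_j. Transposition exchanges the two
   equations. *)

Require Import Defs.
From HB Require Import structures.
From mathcomp Require Import all_boot all_order all_algebra.
From mathcomp Require Import fingroup perm separable.
From mathcomp Require Import mpoly.

Set Implicit Arguments.
Unset Strict Implicit.
Unset Printing Implicit Defensive.

Import GRing.Theory.
Local Open Scope ring_scope.

(** Carries the number of solutions through a change of basis and through transposition. *)
Lemma has_exactly_can (T : eqType) (m : nat) (f g : T -> T)
    (S S' : T -> Prop) :
  cancel f g -> cancel g f -> (forall x, S x <-> S' (f x)) ->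
  has_exactly m S' -> has_exactly m S.
Proof.
move=> fK gK SS' [s [us sz_s sP]]; exists (map g s).
split; rewrite ?size_map ?(map_inj_uniq (can_inj gK)) // => x.
by rewrite SS' -sP -{1}(fK x) (mem_map (can_inj gK)).
Qed.

(** For a scalar unknown both equations lead to this matrix, so one determinant serves both. *)
Definition pencil (R : comNzRingType) (k n : nat) (C : 'I_k -> 'M[R]_n) :
    'M[{poly R}]_n :=
  'X^k%:M + \sum_(r < k) 'X^r *: map_mx (@polyC R) (C r).

(** * The pencil and its determinant *)

Section Pencil.

Variables (k n : nat).

Lemma map_pencil (R S : comNzRingType) (f : {rmorphism R -> S})
    (C : 'I_k -> 'M[R]_n) :
  map_mx (map_poly f) (pencil C) = pencil (fun r => map_mx f (C r)).
Proof.
rewrite /pencil raddfD /= map_scalar_mx /= map_polyXn raddf_sum /=.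
congr (_ + _); apply: eq_bigr => r _; apply/matrixP => i j.
by rewrite !mxE rmorphM /= map_polyXn map_polyC.
Qed.

Lemma pencil_entry (R : comNzRingType) (C : 'I_k -> 'M[R]_n) i j :
  pencil C i j = 'X^k *+ (i == j) + \sum_(r < k) C r i j *: 'X^r.
Proof.
rewrite !mxE summxE; congr (_ + _); apply: eq_bigr => r _.
by rewrite !mxE mulrC mul_polyC.
Qed.

Lemma size_sum_Xn (R : nzRingType) (c : 'I_k -> R) :
  (size (\sum_(r < k) c r *: 'X^r)%R <= k)%N.
Proof.
apply: leq_trans (size_sum _ _ _) _; apply/bigmax_leqP => r _.
by apply: leq_trans (size_scale_leq _ _) _; rewrite size_polyXn.
Qed.

Lemma size_monic_Xn (R : nzRingType) (c : 'I_k -> R) :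
  size ('X^k + \sum_(r < k) c r *: 'X^r) = k.+1.
Proof. by rewrite size_polyDl size_polyXn // ltnS size_sum_Xn. Qed.

Lemma monic_Xn (R : nzRingType) (c : 'I_k -> R) :
  'X^k + \sum_(r < k) c r *: 'X^r \is monic.
Proof.
by rewrite monicE lead_coefDl ?lead_coefXn // size_polyXn ltnS size_sum_Xn.
Qed.

(** In the Leibniz expansion the identity contributes a product of [n] monic polynomials of degree
    [k]; any other permutation picks an off-diagonal entry, of degree below [k]. *)
Lemma monic_det_pencil (R : idomainType) (C : 'I_k -> 'M[R]_n) :
  \det (pencil C) \is monic.
Proof.
have diagE i : pencil C i i = 'X^k + \sum_(r < k) C r i i *: 'X^r.
  by rewrite pencil_entry eqxx.
have size_diag i : size (pencil C i i) = k.+1.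
  by rewrite diagE size_monic_Xn.
have monic_diag i : pencil C i i \is monic by rewrite diagE monic_Xn.
rewrite /determinant (bigD1 1%g) //= odd_perm1 expr0 mul1r.
under eq_bigr do rewrite perm1.
have mon : \prod_(i < n) pencil C i i \is monic by apply: monic_prod.
rewrite monicE lead_coefDl ?(monicP mon) //.
rewrite size_prod => [|i _]; last by rewrite monic_neq0.
rewrite [X in (_ < X.+1 - _)%N](eq_bigr (fun=> k.+1)) => [|i _]; last exact: size_diag.
rewrite sum_nat_const cardT size_enum_ord mulnS subSn ?leq_addr // addKn ltnS.
apply: leq_trans (size_sum _ _ _) _; apply/bigmax_leqP=> s nt_s.
have{nt_s} [i nfix_i]: exists i, s i != i.
  apply/existsP; rewrite -negb_forall; apply: contra nt_s => s_1.
  by apply/eqP/permP=> i; apply/eqP; rewrite perm1 (forallP s_1).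
rewrite size_Msign; apply: leq_trans (size_prod_leq _ _) _.
rewrite cardT size_enum_ord (bigD1 i) //=.
have size_i : (size (pencil C i (s i)) <= k)%N.
  by rewrite pencil_entry eq_sym (negPf nfix_i) add0r size_sum_Xn.
have size_rest : (\sum_(j < n | j != i) size (pencil C j (s j)) <= n.-1 * k.+1)%N.
  have -> : n.-1 = #|[pred j : 'I_n | j != i]|.
    by rewrite -[X in X.-1]card_ord -(cardC1 i).
  rewrite -sum_nat_const; apply: leq_sum => j _; rewrite pencil_entry.
  case: eqP => _; first by rewrite size_monic_Xn.
  by rewrite add0r ltnW // ltnS size_sum_Xn.
have n_gt0 := leq_ltn_trans (leq0n i) (ltn_ord i).
(* The sizes add up to at most [k + n.-1 * k.+1], so the product of the [n] factors has size at most
   [n * k], one less than the diagonal product. *)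
rewrite leq_subLR -mulnS -[in leqRHS](prednK n_gt0) mulSn addSn.
by rewrite ltnS leq_add.
Qed.

Lemma det_pencil_diag (R : comNzRingType) (d : 'I_k -> 'rV[R]_n) :
  \det (pencil (fun r => diag_mx (d r))) =
  \prod_(j < n) ('X^k + \sum_(r < k) d r 0 j *: 'X^r).
Proof.
pose e := \row_(j < n) ('X^k + \sum_(r < k) d r 0 j *: 'X^r).
rewrite (eq_bigr (e 0)) => [|j _]; last by rewrite mxE.
rewrite -det_diag; congr (\det _); apply/matrixP => i j.
rewrite pencil_entry !mxE.
case: eqP => [->|/eqP neq_ij].
  by congr (_ + _); apply: eq_bigr => r _; rewrite !mxE eqxx.
rewrite add0r big1 // => r _.
by rewrite mxE (negPf neq_ij) mulr0n scale0r.
Qed.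

Lemma det_pencil_tr (R : comNzRingType) (C : 'I_k -> 'M[R]_n) :
  \det (pencil (fun r => (C r)^T)) = \det (pencil C).
Proof.
rewrite -[RHS]det_tr; congr (\det _); apply/matrixP => i j.
rewrite [RHS]mxE !pencil_entry eq_sym; congr (_ + _).
by apply: eq_bigr => r _; rewrite mxE.
Qed.

Lemma det_pencil_conj (R : comUnitRingType) (P : 'M[R]_n)
    (C : 'I_k -> 'M[R]_n) : P \in unitmx ->
  \det (pencil (fun r => P *m C r *m invmx P)) = \det (pencil C).
Proof.
move=> Pu; pose P' := map_mx (@polyC R) P; pose Q' := map_mx (@polyC R) (invmx P).
have PQ : P' *m Q' = 1%:M by rewrite -map_mxM mulmxV // map_mx1.
have -> : pencil (fun r => P *m C r *m invmx P) = P' *m pencil C *m Q'.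
  rewrite mulmxDr mulmxDl mul_mx_scalar -scalemxAl PQ scalemx1.
  congr (_ + _); rewrite mulmx_sumr mulmx_suml; apply: eq_bigr => r _.
  by rewrite -scalemxAr -scalemxAl -!map_mxM.
by rewrite !det_mulmx mulrAC -det_mulmx PQ det1 mul1r.
Qed.

End Pencil.

(* Evaluating at 0 the resultant of [p^:P] and [q^:P] yields a resultant of [p]
   and [q] over a coefficient ring that need not be a polynomial ring, which is
   the only case covered by [map_resultant]. *)
Lemma rmorph_resultant (R : comNzRingType) (S : nzRingType)
    (g : {rmorphism R -> S}) (p q : {poly R}) :
  g (lead_coef p) != 0 -> g (lead_coef q) != 0 ->
  g (resultant p^:P q^:P).[0] = resultant (map_poly g p) (map_poly g q).
Proof.
have map_gP (r : {poly R}) : map_poly (g \o horner_eval 0) r^:P = map_poly g r.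
  rewrite -map_poly_comp; apply: eq_map_poly => x /=.
  by rewrite /horner_eval hornerC.
have lead_gP (r : {poly R}) :
    (g \o horner_eval 0) (lead_coef r^:P) = g (lead_coef r).
  rewrite lead_coef_map_inj //; last exact: polyC_inj.
  by rewrite /= /horner_eval hornerC.
move=> gp gq; rewrite -[LHS]/((g \o horner_eval 0) (resultant p^:P q^:P)).
rewrite map_resultant; last by rewrite [X in X != 0]lead_gP.
  by congr resultant; apply: map_gP.
by rewrite [X in X != 0]lead_gP.
Qed.

(** Names the valuation inside [eval_entries], which thus inherits the morphism structure of
    [mmap]. *)
Definition entry_value (T : Type) (k n : nat) (B : 'I_k -> 'M[T]_n)
    (v : 'I_#|entry k n|) : T :=
  let: (r, i, j) := (enum_val v : entry k n) in B r i j.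

(** * Evaluation of polynomials at a tuple of matrices *)

Section Evaluation.

Variables (L : fieldType) (iota : {rmorphism rat -> L}) (k n : nat).
Variable B : 'I_k -> 'M[L]_n.

HB.instance Definition _ :=
  GRing.RMorphism.copy (eval_entries iota B) (mmap iota (entry_value B)).

Lemma eval_indet_mx r : map_mx (eval_entries iota B) (indet_mx n r) = B r.
Proof.
apply/matrixP => i j.
by rewrite !mxE /eval_entries mmapX mmap1U enum_rankK.
Qed.

Lemma eval_comm_ideal P : (forall r s, B r *m B s = B s *m B r) ->
  in_comm_ideal P -> eval_entries iota B P = 0.
Proof.
move=> commB [c ->]; rewrite raddf_sum big1 //= => r _.
rewrite raddf_sum big1 //= => s _; rewrite raddf_sum big1 //= => i _.
rewrite raddf_sum big1 //= => j _; rewrite rmorphM /=.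
set M := _ - _; have -> : eval_entries iota B (M i j) =
  map_mx (eval_entries iota B) M i j by rewrite [RHS]mxE.
by rewrite map_mxB !map_mxM /= !eval_indet_mx commB subrr mxE mulr0.
Qed.

End Evaluation.

(** * Transfer from a rational commuting tuple to the generic one *)

Section Generic.

Variables (L : fieldType) (iota : {rmorphism rat -> L}) (k n : nat).
Variable B : 'I_k -> 'M[L]_n.
Hypothesis genB : generic_commuting iota B.

(** Constant nonzero leading coefficients preserve the degrees under evaluation, so one polynomial
    [P] in the entries, the resultant, detects coprimality at [D] and at [B] alike. *)
Lemma generic_coprime (p q : {poly {mpoly rat[#|entry k n|]}})
    (D : 'I_k -> 'M[rat]_n) (c d : rat) :
  c != 0 -> lead_coef p = c%:MP -> d != 0 -> lead_coef q = d%:MP ->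
  (forall r s, D r *m D s = D s *m D r) ->
  let e := [eta eval_entries idfun D] in let f := [eta eval_entries iota B] in
  coprimep (map_poly e p) (map_poly e q) ->
  coprimep (map_poly f p) (map_poly f q).
Proof.
move=> c0 lp d0 lq commD e f.
pose P := (resultant p^:P q^:P).[0].
have eval_nz (F : fieldType) (i : {rmorphism rat -> F}) C (a : rat) :
    a != 0 -> eval_entries i (C : 'I_k -> 'M[F]_n) a%:MP != 0.
  by rewrite /eval_entries mmapC fmorph_eq0.
have copE (F : fieldType) (i : {rmorphism rat -> F}) (C : 'I_k -> 'M[F]_n) :
    coprimep (map_poly (eval_entries i C) p) (map_poly (eval_entries i C) q) =
    (eval_entries i C P != 0).
  rewrite rmorph_resultant ?lp ?lq ?eval_nz // resultant_eq0 /coprimep.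
  rewrite -leqNgt eqn_leq size_poly_gt0 gcdp_eq0 negb_and.
  by rewrite -lead_coef_eq0 lead_coef_map_eq lp ?eval_nz // andbT.
rewrite !copE.
(* Were [P] in the ideal, it would vanish at the commuting tuple [D]. *)
move=> nzP; apply: (genB.2) => PI; case/eqP: nzP.
exact: eval_comm_ideal.
Qed.

Lemma generic_separable (p : {poly {mpoly rat[#|entry k n|]}})
    (D : 'I_k -> 'M[rat]_n) :
  p \is monic -> (forall r s, D r *m D s = D s *m D r) ->
  separable_poly (map_poly (eval_entries idfun D) p) ->
  separable_poly (map_poly (eval_entries iota B) p).
Proof.
move=> mon_p commD; rewrite !separable_poly.unlock !deriv_map.
have [/eqP/size_poly1P[a _ pa]|size_p] := eqVneq (size p) 1%N.
  have -> : p = 1 by move: mon_p; rewrite pa monicE lead_coefC => /eqP->.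
  by rewrite !rmorph1 !coprime1p.
have [m sz_p] : exists m, size p = m.+2.
  move: size_p (monic_neq0 mon_p); rewrite -size_poly_eq0.
  by case: (size p) => [|[|m]] // _ _; exists m.
(* As [p] is monic of degree [m.+1], its derivative has this integer as leading coefficient: a
   constant, nonzero in characteristic 0. *)
have coef_dp : p^`()`_m = m.+1%:R.
  by have := monicP mon_p; rewrite coef_deriv lead_coefE sz_p /= => ->.
have nz : m.+1%:R != 0 :> rat by rewrite Num.Theory.pnatr_eq0.
have nz' : m.+1%:R != 0 :> {mpoly rat[#|entry k n|]}.
  by rewrite -(rmorph_nat (@mpolyC _ _)) mpolyC_eq0.
have sz_dp : size p^`() = m.+1.
  apply/eqP; rewrite eqn_leq -ltnS -sz_p lt_size_deriv ?monic_neq0 //=.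
  rewrite ltnNge; apply: contra nz' => /leq_sizeP/(_ m (leqnn _)).
  by rewrite coef_dp => ->.
apply: (generic_coprime (c := 1) (d := m.+1%:R)) => //.
- by rewrite (monicP mon_p).
- by rewrite lead_coefE sz_dp coef_dp raddfMn.
Qed.

Lemma generic_char_poly_separable r : separable_poly (char_poly (B r)).
Proof.
rewrite -(eval_indet_mx iota B r) -map_char_poly.
(* All matrices of the test tuple equal the diagonal matrix with entries [0, ..., n - 1], whose
   eigenvalues are distinct. *)
pose D (_ : 'I_k) : 'M[rat]_n := diag_mx (\row_(j < n) j%:R).
apply: (generic_separable (D := D)); first exact: char_poly_monic.
  by [].
rewrite map_char_poly eval_indet_mx char_poly_trig ?diag_mx_is_trig //.
under eq_bigr do rewrite !mxE eqxx mulr1n.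
rewrite -(big_map (fun j : 'I_n => j%:R) xpredT (fun x : rat => 'X - x%:P)).
rewrite separable_prod_XsubC map_inj_uniq ?index_enum_uniq // => i j /eqP.
by rewrite Num.Theory.eqr_nat => /eqP/val_inj.
Qed.

Lemma generic_pencil_separable : separable_poly (\det (pencil B)).
Proof.
have pencilE (F : fieldType) (i : {rmorphism rat -> F}) (C : 'I_k -> 'M[F]_n) :
    \det (pencil C) =
    map_poly (eval_entries i C) (\det (pencil (@indet_mx k n))).
  rewrite -det_map_mx map_pencil; congr (\det _); apply/matrixP => a b.
  by rewrite !pencil_entry; under [in RHS]eq_bigr do rewrite eval_indet_mx.
(* [h] gives [n * k] distinct rationals. [f j] has the [k] roots [h (j, i)], and its coefficients
   below degree [k] fill the [j]-th diagonal places of [D], so the determinant is the product of the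
   [f j]. *)
pose h (x : 'I_n * 'I_k) : rat := (enum_rank x)%:R.
pose f (j : 'I_n) : {poly rat} := \prod_(i < k) ('X - (h (j, i))%:P).
pose D r : 'M[rat]_n := diag_mx (\row_(j < n) (f j)`_r).
rewrite (pencilE _ iota).
apply: (generic_separable (D := D)); first exact: monic_det_pencil.
  by move=> r s; rewrite diag_mxC.
rewrite -pencilE det_pencil_diag.
have fE j : 'X^k + \sum_(r < k) (\row_(j < n) (f j)`_r) 0 j *: 'X^r = f j.
  have sz : size (f j) = k.+1.
    by rewrite size_prod_XsubC /index_enum -enumT size_enum_ord.
  have /monicP : f j \is monic by apply: monic_prod_XsubC.
  rewrite lead_coefE sz /= => lc.
  rewrite -[RHS]coefK sz poly_def big_ord_recr /= lc scale1r addrC.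
  by congr (_ + _); apply: eq_bigr => r _; rewrite mxE.
under eq_bigr do rewrite fE.
rewrite pair_bigA (eq_bigr (fun x => 'X - (h x)%:P)) => [|[]//].
rewrite -(big_map h xpredT (fun x : rat => 'X - x%:P)).
rewrite separable_prod_XsubC map_inj_uniq ?index_enum_uniq // => x y /eqP.
by rewrite Num.Theory.eqr_nat => /eqP/val_inj/enum_rank_inj.
Qed.

End Generic.

(** * Diagonal coefficients *)

Section DiagonalCoefficients.

Variables (F : closedFieldType) (k n' : nat).
Let n := n'.+1.
Variable d : 'I_k -> 'rV[F]_n.

Let f (j : 'I_n) : {poly F} := 'X^k + \sum_(r < k) d r 0 j *: 'X^r.
Let D (r : 'I_k) : 'M[F]_n := diag_mx (d r).

Lemma diag_delta_mx (e : 'rV[F]_n) j :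
  diag_mx e * delta_mx j j = e 0 j *: delta_mx j j.
Proof.
apply/matrixP => a b; rewrite -[_ * _]/(_ *m _) mul_diag_mx !mxE.
by case: eqP => [->|] //=; rewrite !mulr0.
Qed.

(** The [j]-th basis vector is an eigenvector of each [D r], so on that column the right
    coefficients act as the scalars [d r 0 j]. *)
Lemma horner_mx_col_poly (X : 'M[F]_n) j :
  horner_mx X (f j) * delta_mx j j =
  (X ^+ k + \sum_(r < k) X ^+ r *m D r) * delta_mx j j.
Proof.
rewrite rmorphD /= rmorphXn /= horner_mx_X rmorph_sum /= !mulrDl.
congr (_ + _); rewrite !mulr_suml; apply: eq_bigr => r _.
rewrite horner_mxZ rmorphXn /= horner_mx_X -[_ *m D r]/(_ * D r) -mulrA.
by rewrite diag_delta_mx -scalerAl scalerAr.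
Qed.

Hypothesis sep_f : separable_poly (\prod_j f j).

(* The polynomials [f j] being pairwise coprime while [f j] of [X] kills the
   [j]-th basis vector, each coordinate projection is a polynomial in [X]. *)
Lemma right_coef_solution_diag_mx (X : 'M[F]_n) :
  right_coef_solution D X -> X = diag_mx (\row_j X j j).
Proof.
move=> solX; have fX j : horner_mx X (f j) * delta_mx j j = 0.
  by rewrite horner_mx_col_poly [X in X * _]solX mul0r.
have commX j : X * delta_mx j j = delta_mx j j * X.
  pose h := \prod_(i | i != j) f i.
  have cop : coprimep (f j) h.
    by apply: separable_coprime sep_f _; rewrite (bigD1 j).
  have /Bezout_eq1_coprimepP[[u v] /= uv1] := cop.
  suff <- : horner_mx X (v * h) = delta_mx j j.
    by have := comm_horner_mx2 X 'X (v * h); rewrite horner_mx_X.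
  (* [v * h] acts on column [j] as [1 - u * f j], hence as 1; on column [i] its factor [f i] gives
     0. *)
  have Pj : horner_mx X (v * h) * delta_mx j j = delta_mx j j.
    have -> : v * h = 1 - u * f j by rewrite -uv1 addrC addKr.
    by rewrite rmorphB rmorph1 rmorphM mulrBl mul1r -mulrA fX mulr0 subr0.
  have Pi i : i != j -> horner_mx X (v * h) * delta_mx i i = 0.
    move=> neq_ij; rewrite /h (bigD1 i) //= [f i * _]mulrC mulrA.
    by rewrite rmorphM -mulrA fX mulr0.
  rewrite -[LHS]mulr1 -[1]/(1%:M) (@mx1_sum_delta F n) mulr_sumr (bigD1 j) //=.
  by rewrite Pj big1 ?addr0.
apply/matrixP => i j; rewrite !mxE; case: eqP => [->//|/eqP neq_ij].
(* At [(i, j)] the left product has entry [X i j] and the right one has 0. *)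
have /matrixP/(_ i j) := commX j.
rewrite !mxE (bigD1 j) //= big1 => [|l neq_lj]; last first.
  by rewrite mxE (negPf neq_lj) mulr0.
rewrite mxE !eqxx mulr1 addr0 big1 => // l _.
by rewrite mxE (negPf neq_ij) mul0r.
Qed.

Lemma right_coef_solution_diagP (x : 'rV[F]_n) :
  right_coef_solution D (diag_mx x) <-> forall j, root (f j) (x 0 j).
Proof.
have entryE : diag_mx x ^+ k + \sum_(r < k) diag_mx x ^+ r *m D r =
    diag_mx (\row_j (f j).[x 0 j]).
  have XE m : (diag_mx x) ^+ m = diag_mx (\row_j x 0 j ^+ m).
    rewrite -{1}(horner_mx_X (diag_mx x)) -rmorphXn /= horner_mx_diag.
    by congr diag_mx; apply/rowP => i; rewrite !mxE hornerXn.
  rewrite XE; under eq_bigr do rewrite XE mulmx_diag.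
  rewrite -linear_sum -linearD; congr diag_mx; apply/rowP => i.
  rewrite !mxE summxE hornerD hornerXn horner_sum; congr (_ + _).
  by apply: eq_bigr => r _; rewrite !mxE hornerZ hornerXn mulrC.
rewrite /right_coef_solution entryE; split => [/matrixP sol j|rootf].
  by have := sol j j; rewrite !mxE eqxx mulr1n /root => ->.
apply/matrixP => i j; rewrite !mxE (eqP (rootf i)).
by rewrite mul0rn.
Qed.

(** Separability of the product passes to each [f j], which thus has [k] distinct roots; the [n]
    diagonal entries are chosen independently among them. *)
Lemma right_coef_solution_diag_card :
  has_exactly (k ^ n) (right_coef_solution D).
Proof.
have root_seq j : {s : seq F |
    [/\ uniq s, size s = k & forall x, root (f j) x = (x \in s)]}.
  have [s sE] := closed_field_poly_normal (f j); exists s.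
  have mon_f : f j \is monic by apply: monic_Xn.
  rewrite (monicP mon_f) scale1r in sE.
  have sep : separable_poly (f j).
    by apply: dvdp_separable sep_f; rewrite (bigD1 j) //= dvdp_mulr.
  split; first by rewrite -separable_prod_XsubC -sE.
    have := size_monic_Xn (fun r => d r 0 j).
    by rewrite -/(f j) sE size_prod_XsubC => -[].
  by move=> x; rewrite sE root_prod_XsubC.
pose s j := sval (root_seq j).
have us j : uniq (s j) by rewrite /s; case: (root_seq j) => ? [].
have szs j : size (s j) = k by rewrite /s; case: (root_seq j) => ? [].
have sP j x : root (f j) x = (x \in s j) by rewrite /s; case: (root_seq j) => ? [].
(* [g j] is the position of the chosen root in [s j], a list of size [k], so the default value of
   the lookup never occurs. *)
pose S (g : {ffun 'I_n -> 'I_k}) : 'M[F]_n := diag_mx (\row_j (s j)`_(g j)).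
have S_inj : injective S.
  move=> g g' /matrixP eqS; apply/ffunP => j; apply/val_inj/eqP.
  have /eqP := eqS j j.
  by rewrite !mxE eqxx !mulr1n nth_uniq ?szs.
exists (map S (enum {ffun 'I_n -> 'I_k})); split.
- by rewrite map_inj_uniq ?enum_uniq.
- by rewrite size_map -cardE card_ffun !card_ord.
move=> X; split => [/mapP[g _ ->]|solX].
  by apply/right_coef_solution_diagP => j; rewrite mxE sP mem_nth ?szs.
have XE := right_coef_solution_diag_mx solX.
have rootX j : root (f j) (X j j).
  move: solX; rewrite {1}XE => /right_coef_solution_diagP/(_ j).
  by rewrite mxE.
have lt_k j : (index (X j j) (s j) < k)%N.
  by rewrite -[X in (_ < X)%N](szs j) index_mem -sP.
apply/mapP; exists [ffun j => Ordinal (lt_k j)]; first by rewrite mem_enum.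
rewrite [LHS]XE /S; congr diag_mx; apply/rowP => j.
by rewrite !mxE ffunE /= nth_index // -sP.
Qed.

End DiagonalCoefficients.

(** * Reduction of commuting coefficients to diagonal ones *)

Section CommutingCoefficients.

Variables (F : closedFieldType) (k n' : nat).
Let n := n'.+1.
Variable C : 'I_k -> 'M[F]_n.

Hypothesis commC : forall r s, C r *m C s = C s *m C r.
Hypothesis sepC : forall r, separable_poly (char_poly (C r)).

(** The minimal polynomial divides the split separable characteristic polynomial, so each [C r] is
    diagonalizable; commutation makes this simultaneous. *)
Lemma separable_codiagonalizable :
  exists2 P : 'M[F]_n, P \in unitmx &
    exists d : 'I_k -> 'rV[F]_n, forall r, P *m C r *m invmx P = diag_mx (d r).
Proof.
have [P Pu diagP] : codiagonalizable [seq C r | r <- enum 'I_k].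
  apply/codiagonalizableP.
  split=> [_ _ /mapP[r _ ->] /mapP[s _ ->]|_ /mapP[r _ ->]].
    exact: commC.
  have [s sE] := closed_field_poly_normal (char_poly (C r)).
  rewrite (monicP (char_poly_monic _)) scale1r in sE.
  apply/diagonalizableP; exists s; last by rewrite -sE mxminpoly_dvd_char.
  by rewrite -separable_prod_XsubC -sE.
exists P => //; exists (fun r => \row_j (P *m C r *m invmx P) j j) => r.
have /(allP diagP)/= : C r \in [seq C r | r <- enum 'I_k].
  by rewrite map_f ?mem_enum.
move=> /(diagonalizable_forP _ Pu) diagC; apply/matrixP => i j.
rewrite [RHS]mxE; case: (i =P j) => [->|/eqP/diagC-> //].
by rewrite [in RHS]mxE.
Qed.

Hypothesis sep_pencil : separable_poly (\det (pencil C)).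

Lemma right_coef_solution_comm :
  has_exactly (k ^ n) (right_coef_solution C) /\
  forall X, right_coef_solution C X -> forall r, X *m C r = C r *m X.
Proof.
have [P Pu [d dE]] := separable_codiagonalizable.
have sep_d : separable_poly
    (\prod_(j < n) ('X^k + \sum_(r < k) d r 0 j *: 'X^r)).
  rewrite -det_pencil_diag.
  move: sep_pencil; rewrite -(det_pencil_conj C Pu).
  suff -> : pencil (fun r => diag_mx (d r)) =
      pencil (fun r => P *m C r *m invmx P) by [].
  by congr (_ + _); apply: eq_bigr => r _; rewrite dE.
pose f (X : 'M[F]_n) := P *m X *m invmx P.
pose g (X : 'M[F]_n) := invmx P *m X *m P.
have fK : cancel f g by move=> X; rewrite /f /g !mulmxA mulVmx // mul1mx mulmxKV.
have gK : cancel g f by move=> X; rewrite /f /g !mulmxA mulmxV // mul1mx mulmxK.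
have fM X Y : f (X *m Y) = f X *m f Y by rewrite /f !mulmxA mulmxKV.
have fX X m : f (X ^+ m) = f X ^+ m.
  elim: m => [|m IHm]; first by rewrite !expr0 /f mulmx1 mulmxV.
  by rewrite !exprS -IHm; apply: fM.
have solE X : right_coef_solution C X <->
    right_coef_solution (fun r => diag_mx (d r)) (f X).
  rewrite /right_coef_solution.
  have -> : f X ^+ k + \sum_(r < k) f X ^+ r *m diag_mx (d r) =
      f (X ^+ k + \sum_(r < k) X ^+ r *m C r).
    rewrite [RHS]/f mulmxDr mulmxDl; congr (_ + _); first by rewrite -fX.
    rewrite mulmx_sumr mulmx_suml; apply: eq_bigr => r _.
    by rewrite -/(f _) fM fX -dE.
  split=> [->|/(congr1 g)]; first by rewrite /f mulmx0 mul0mx.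
  by rewrite fK /g mulmx0 mul0mx.
split.
  exact: has_exactly_can fK gK solE (right_coef_solution_diag_card sep_d).
move=> X /solE/(right_coef_solution_diag_mx sep_d) fXE r.
(* After conjugation both matrices are diagonal, hence commute. *)
by apply: (can_inj fK); rewrite !fM /= {2 3}/f dE fXE diag_mxC.
Qed.

End CommutingCoefficients.

(** * Transposition and passage from [L] to [Kbar] *)

Lemma left_coef_solution_tr (F : fieldType) (k n : nat) (C : 'I_k -> 'M[F]_n) X :
  left_coef_solution C X <-> right_coef_solution (fun r => (C r)^T) X^T.
Proof.
have trX (Y : 'M[F]_n) m : (Y ^+ m)^T = Y^T ^+ m.
  elim: m => [|m IHm]; first by rewrite !expr0 trmx1.
  by rewrite exprSr exprS trmx_mul IHm.
rewrite /left_coef_solution /right_coef_solution.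
have -> : X^T ^+ k + \sum_(r < k) X^T ^+ r *m (C r)^T =
    (X ^+ k + \sum_(r < k) C r *m X ^+ r)^T.
  rewrite linearD linear_sum /= trX; congr (_ + _).
  by apply: eq_bigr => r _; rewrite trmx_mul trX.
split=> [->|/(congr1 trmx)]; first by rewrite trmx0.
by rewrite trmxK trmx0.
Qed.

Lemma char_poly_tr (R : comNzRingType) n (A : 'M[R]_n) :
  char_poly A^T = char_poly A.
Proof.
rewrite /char_poly -[RHS]det_tr; congr (\det _); apply/matrixP => i j.
by rewrite !mxE eq_sym.
Qed.

Theorem theorem3
  (k n : nat) (hk : (2 <= k)%N) (hn : (2 <= n)%N)
  (L : fieldType) (iota : {rmorphism rat -> L})
  (hL : transcendental_extension iota)
  (B : 'I_k -> 'M[L]_n) (hB : generic_commuting iota B)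
  (K : fieldType) (inc : {rmorphism K -> L})
  (hK : forall x : L, (exists y : K, inc y = x) <-> in_entry_field iota B x)
  (BK : 'I_k -> 'M[K]_n) (hBK : forall r, map_mx inc (BK r) = B r)
  (Kbar : closedFieldType) (emb : {rmorphism K -> Kbar})
  (hKbar : is_algebraic_closure emb) :
  let Bbar := fun r : 'I_k => map_mx emb (BK r) in
  (has_exactly (k ^ n) (right_coef_solution Bbar) /\
   forall X : 'M[Kbar]_n, right_coef_solution Bbar X ->
     forall r : 'I_k, X *m Bbar r = Bbar r *m X) /\
  (has_exactly (k ^ n) (left_coef_solution Bbar) /\
   forall X : 'M[Kbar]_n, left_coef_solution Bbar X ->
     forall r : 'I_k, X *m Bbar r = Bbar r *m X).
Proof.
case: n hn B hB hK BK hBK => // n' hn B hB hK BK hBK Bbar.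
have commK r s : BK r *m BK s = BK s *m BK r.
  by apply: (map_mx_inj (f := inc)); rewrite !map_mxM !hBK hB.1.
have commB r s : Bbar r *m Bbar s = Bbar s *m Bbar r.
  by rewrite -!map_mxM commK.
(* Separability is insensitive to field extension, so it descends from [L] to [K] and then ascends
   to [Kbar]. *)
have sep_char r : separable_poly (char_poly (Bbar r)).
  rewrite -map_char_poly separable_map -(separable_map inc) map_char_poly hBK.
  exact: generic_char_poly_separable hB r.
have sep_pencil : separable_poly (\det (pencil Bbar)).
  rewrite -map_pencil det_map_mx separable_map -(separable_map inc) -det_map_mx.
  rewrite map_pencil.
  suff -> : pencil (fun r => map_mx inc (BK r)) = pencil B.
    exact: generic_pencil_separable hB.
  by congr (_ + _); apply: eq_bigr => r _; rewrite hBK.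
split; first exact: right_coef_solution_comm.
(* The transposes still commute and have the same characteristic polynomials and pencil
   determinant. *)
pose Bt r := (Bbar r)^T.
have [||| card_t comm_t] := @right_coef_solution_comm _ _ _ Bt.
- by move=> r s; rewrite -!trmx_mul commB.
- by move=> r; rewrite char_poly_tr.
- by rewrite det_pencil_tr.
split=> [|X /left_coef_solution_tr/comm_t commX r].
  apply: has_exactly_can (@trmxK _ _ _) (@trmxK _ _ _) _ card_t => X.
  exact: left_coef_solution_tr.
by apply: trmx_inj; rewrite !trmx_mul commX.
Qed.
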